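(* Let $(P_n)_{n\ge0}$ and $(Q_n)_{n\ge0}$ be two monic orthogonal polynomial sequences (MOPSs) with respect to the regular functionals $\mathbf u$ and $\mathbf v$, respectively, normalized by $\langle\mathbf u,1\rangle=1=\langle\mathbf v,1\rangle$. Assume that there exist sequences of complex numbers $(r_n)_{n\ge0}$, $(s_n)_{n\ge0}$, $(t_n)_{n\ge0}$, with $r_0=s_0=t_0=t_1=0$, such that $$Q_n(x)+r_nQ_{n-1}(x)=P_n(x)+s_nP_{n-1}(x)+t_nP_{n-2}(x),\qquad n\ge0,$$ and such that the initial conditions $t_2\neq r_2(s_1-r_1)$ and $r_3t_3\ne0$ hold. Let $$c:=\beta_0-\frac{\gamma_1}{r_3}\,\frac{t_3-r_3(s_2-r_2)}{t_2-r_2(s_1-r_1)},$$ where $\beta_0$ and $\gamma_1$ are recurrence coefficients of $(P_n)_n$. Then the following statements are equivalent: (i) The functional $(x-c)\mathbf u$ is regular. (ii) $t_n\neq r_n(s_{n-1}-r_{n-1})$ for all $n\ge2$.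
   Context: A functional here is a linear functional $\mathbf w$ on the space of complex polynomials in one variable; $\langle\mathbf w,p\rangle$ is its value at $p$. For a polynomial $\phi$, the functional $\phi\mathbf w$ is defined by $\langle\phi\mathbf w,p\rangle=\langle\mathbf w,\phi p\rangle$. A MOPS with respect to $\mathbf w$ is a sequence $(R_n)_{n\ge0}$ of monic polynomials with $\deg R_n=n$, $\langle\mathbf w,R_nR_m\rangle=0$ for $n\ne m$ and $\langle\mathbf w,R_n^2\rangle\neq0$ for all $n$; $\mathbf w$ is regular (quasi-definite) if such a sequence exists. Polynomials with negative index are zero. The recurrence coefficients $(\beta_n)_{n\ge0}$, $(\gamma_n)_{n\ge1}$ of $(P_n)_n$ are the complex numbers ($\gamma_n\neq0$) such that $P_{n+1}(x)=(x-\beta_n)P_n(x)-\gamma_nP_{n-1}(x)$, $n\ge0$, with $P_0=1$, $P_{-1}=0$. *)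

(* Defs.v *)
From HB Require Import structures.
From mathcomp Require Import all_boot all_order all_algebra.

Set Implicit Arguments.
Unset Strict Implicit.
Unset Printing Implicit Defensive.

Import GRing.Theory.
Local Open Scope ring_scope.

(* Linear functionals on {poly F} are elements of {scalar {poly F}}. *)

(* The functional phi w, i.e. <phi w, p> = <w, phi p>. *)
Definition mulfunctional (F : fieldType) (phi : {poly F}) (w : {scalar {poly F}}) :
  {poly F} -> F := fun p => w (phi * p).

Fact mulfunctional_is_scalar (F : fieldType) (phi : {poly F}) (w : {scalar {poly F}}) :
  scalar (mulfunctional phi w).
Proof. by move=> a p q; rewrite /mulfunctional mulrDr -scalerAr linearP. Qed.

HB.instance Definition _ (F : fieldType) (phi : {poly F})
    (w : {scalar {poly F}}) :=
  GRing.isLinear.Build F {poly F} F *%R (mulfunctional phi w) (mulfunctional_is_scalar phi w).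

Definition MOPS (F : fieldType) (w : {scalar {poly F}})
    (P : nat -> {poly F}) : Prop :=
  [/\ forall n, P n \is monic,
      forall n, size (P n) = n.+1 (* deg (P n) = n *),
      forall n m, n != m -> w (P n * P m) = 0
    & forall n, w (P n ^+ 2) != 0].

Definition regular (F : fieldType) (w : {scalar {poly F}}) : Prop :=
  exists P : nat -> {poly F}, MOPS w P.

(* lag k P n is P_{n-k}, with the convention that polynomials of negative
   index are zero (truncated subtraction alone would give P_0). *)
Definition lag (F : fieldType) (k : nat) (P : nat -> {poly F}) (n : nat) :
  {poly F} := if (k <= n)%N then P (n - k)%N else 0.

(* gamma 0 is a junk value: it only multiplies P_{-1} = 0. *)
Definition recurrence_coeffs (F : fieldType) (P : nat -> {poly F})
    (beta gamma : nat -> F) : Prop :=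
  [/\ P 0%N = 1,
      forall n, (1 <= n)%N -> gamma n != 0
    & forall n, P n.+1 = ('X - (beta n)%:P) * P n - gamma n *: lag 1 P n].

(* Main.v *)
(** Since [u (Q_n P_{n-2}) = (t_n - r_n (s_{n-1} - r_{n-1})) u (P_{n-2}^2)], condition (ii) says that
    [u (Q_n P_{n-2})] never vanishes.  The constant [c] is the one for which [(x - c) u] kills [Q_3];
    the structure relation then makes it kill every [Q_n] with [n >= 3], so that [(x - c) u = Phi v]
    with [deg Phi <= 2].  Dividing [P_{n-2}] by [x - c] gives [u (Q_n P_{n-2}) = P_{n-2}(c) u (Q_n)].
    Moreover [u (Q_n) <> 0] for [n >= 2]: otherwise the structure relation gives [u (Q_m) = 0] for
    all [m >= n], hence [u = pi v] for some polynomial [pi]; from [(x - c) pi = Phi] we get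
    [deg pi <= 1], and [u (Q_2) = 0], contradicting the initial condition.
    So (ii) means that [P_n(c) <> 0] for all [n], the classical criterion for the regularity
    of [(x - c) u]. *)
Require Import Defs.
From mathcomp Require Import all_boot all_order all_algebra.
From mathcomp Require Import reals complex.
From mathcomp Require Import ring.

Import GRing.Theory.
Local Open Scope ring_scope.
Local Open Scope complex_scope.

Section OrthogonalPolynomials.

Context {F : fieldType}.
Implicit Types (w u v f : {scalar {poly F}}) (P Q : nat -> {poly F}) (p q : {poly F}).

Lemma functionalZ {w} a p : w (a *: p) = a * w p.
Proof. exact: linearZ. Qed.

Lemma size_sub_lead {P n q} : P n \is monic -> size (P n) = n.+1 ->
  (size q <= n.+1)%N -> (size (q - q`_n *: P n)%R <= n)%N.
Proof.
move=> mP sP sq; apply/leq_sizeP => j; rewrite leq_eqVlt => /orP[/eqP <-|nj].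
  by rewrite coefB coefZ -[X in (P n)`_X]/(n.+1.-1) -sP -lead_coefE (monicP mP) mulr1 subrr.
have Pj : (P n)`_j = 0 by rewrite nth_default ?sP.
by rewrite coefB coefZ Pj mulr0 subr0 nth_default // (leq_trans sq nj).
Qed.

Lemma scalar_eq0_basis {P f n q} : (forall i, P i \is monic) ->
  (forall i, size (P i) = i.+1) -> (forall i, (i < n)%N -> f (P i) = 0) ->
  (size q <= n)%N -> f q = 0.
Proof.
move=> mP sP; elim: n q => [|n IHn] q f0 sq.
  by move: sq; rewrite leqn0 size_poly_eq0 => /eqP ->; rewrite linear0.
rewrite -(subrK (q`_n *: P n) q) linearD functionalZ f0 // mulr0 addr0.
by apply: IHn (size_sub_lead (mP n) (sP n) sq) => i ni; apply: f0; apply: ltnW.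
Qed.

Lemma MOPS_orth {w P n q} : MOPS w P -> (size q <= n)%N -> w (P n * q) = 0.
Proof.
case=> mP sP oP _; apply: (scalar_eq0_basis (f := mulfunctional (P n) w) mP sP).
by move=> i ni; apply: oP; rewrite neq_ltn ni orbT.
Qed.

Lemma MOPS_coef {w P n q} : MOPS w P -> (size q <= n.+1)%N ->
  w (P n * q) = q`_n * w (P n ^+ 2).
Proof.
move=> hP sq; case: (hP) => mP sP _ _.
rewrite -{1}(subrK (q`_n *: P n) q) mulrDr linearD -scalerAr functionalZ.
by rewrite (MOPS_orth hP (size_sub_lead (mP n) (sP n) sq)) add0r expr2.
Qed.

Lemma MOPS_monic {w P n q} : MOPS w P -> q \is monic -> size q = n.+1 ->
  w (q * P n) = w (P n ^+ 2).
Proof.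
move=> hP mq sq; rewrite mulrC (MOPS_coef hP) ?sq //.
by rewrite -[X in q`_X]/(n.+1.-1) -sq -lead_coefE (monicP mq) mul1r.
Qed.

(** If [d = p - q] had degree m, then [v (Q m * d)] would be its leading coefficient times the
    nonzero [v (Q m ^+ 2)]. *)
Lemma mulfunctional_inj {v Q p q} : MOPS v Q ->
  (forall g, v (p * g) = v (q * g)) -> p = q.
Proof.
move=> hQ e; case: (hQ) => _ _ _ nQ; apply/eqP; rewrite -subr_eq0; apply/negPn/negP => pq0.
set d := p - q in pq0; have sd : size d = (size d).-1.+1 by rewrite prednK // size_poly_gt0.
have : v (Q (size d).-1 * d) = 0 by rewrite mulrC mulrBl linearB /= e subrr.
rewrite (MOPS_coef hQ) -?sd // -lead_coefE => /eqP.
by rewrite mulf_eq0 lead_coef_eq0 (negPf pq0) (negPf (nQ _)).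
Qed.

(** The functionals [Q i] v / [v (Q i ^+ 2)] form the basis dual to [Q], so the expansion of [f] in
    it stops before [m], and its coefficient polynomial is [phi]. *)
Lemma finite_dual_expansion {f v Q m} : MOPS v Q -> (forall n, (m <= n)%N -> f (Q n) = 0) ->
  exists2 phi : {poly F}, (size phi <= m)%N & forall p, f p = v (phi * p).
Proof.
move=> hQ f0; case: (hQ) => mQ sQ oQ nQ.
pose phi : {poly F} := \sum_(i < m) (f (Q i) / v (Q i ^+ 2)) *: Q i.
have vphi j : v (phi * Q j) = f (Q j).
  rewrite /phi mulr_suml linear_sum /=; case: (ltnP j m) => [jm|mj].
    rewrite (bigD1 (Ordinal jm)) //= big1 => [|i ij].
      by rewrite addr0 -scalerAl functionalZ -expr2 divfK.
    by rewrite /= -scalerAl functionalZ (oQ _ _ ij) mulr0.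
  rewrite f0 // big1 // => i _.
  have ij : (i : nat) != j by rewrite neq_ltn (leq_trans (ltn_ord i) mj).
  by rewrite /= -scalerAl functionalZ (oQ _ _ ij) mulr0.
exists phi => [|p].
  apply: (leq_trans (size_sum _ _ _)); apply/bigmax_leqP => i _.
  by apply: (leq_trans (size_scale_leq _ _)); rewrite sQ.
apply/eqP; rewrite -subr_eq0; apply/eqP.
pose g := (f \- (mulfunctional phi v : {scalar {poly F}})) : {poly F} -> F.
apply: (scalar_eq0_basis (f := g) (n := size p) mQ sQ) => // i _.
by rewrite /g /= /mulfunctional vphi subrr.
Qed.

Lemma factor_at p c : exists2 k, p = p.[c]%:P + ('X - c%:P) * k & (size k <= (size p).-1)%N.
Proof.
have /factor_theorem[k ek] : root (p - p.[c]%:P) c by rewrite rootE !hornerE subrr.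
have ep : p = p.[c]%:P + ('X - c%:P) * k by rewrite mulrC -ek addrC subrK.
exists k => //; have [->|k0] := eqVneq k 0; first by rewrite size_poly0.
have : (size (p - p.[c]%:P)%R <= maxn (size p) 1)%N.
  by apply: leq_trans (size_polyD _ _) _; rewrite size_polyN geq_max leq_maxl leq_max
     size_polyC_leq1 orbT.
rewrite ek size_Mmonic ?monicXsubC // size_XsubC addn2 /=.
have sk : (0 < size k)%N by rewrite size_poly_gt0.
by case: (size p) => [|[|n]] //=; rewrite ?leqNgt ltnS ?sk // -ltnNge.
Qed.

(** Forward, a zero of [P n] at [c] would give an orthogonal polynomial of zero norm. Backward, the
    monic kernel (Christoffel) polynomials are an explicit MOPS. *)
Lemma regular_mul_XsubC {u P} c : MOPS u P ->
  regular (mulfunctional ('X - c%:P) u) <-> (forall n, (P n).[c] != 0).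
Proof.
move=> hP; case: (hP) => mP sP oP nP.
have mX : 'X - c%:P \is monic := monicXsubC c.
split=> [[K hK] n|nz].
  apply/negP => /factor_theorem[k ek]; case: (hK) => mK sK _ nK.
  have mk : k \is monic by rewrite -(monicMr _ mX) -ek.
  have sk : size k = n.
    by apply/eqP; rewrite -eqSS -(sP n) ek size_Mmonic ?monic_neq0 // size_XsubC addn2.
  case: n => [|n] in ek sk *.
    by move: (monic_neq0 mk); rewrite -size_poly_eq0 sk.
  (* The value is [u (P n.+1 * K n)], zero by degree; yet [k] is monic of degree [n], so it is also
     the norm of [K n]. *)
  suff /eqP : mulfunctional ('X - c%:P) u (K n * k) = 0.
    by rewrite mulrC MOPS_monic // (negPf (nK n)).
  by rewrite /mulfunctional mulrCA [_ * k]mulrC -ek mulrC (MOPS_orth hP) ?sK.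
(* This ratio makes [N n] vanish at [c], hence divisible by x - c. *)
pose l n := (P n.+1).[c] / (P n).[c].
pose N n := P n.+1 - l n *: P n.
have sl n : (size (- (l n *: P n))%R < size (P n.+1))%N.
  by rewrite size_polyN (leq_ltn_trans (size_scale_leq _ _)) // !sP.
have mN n : N n \is monic by rewrite monicE lead_coefDl ?sl // (monicP (mP _)).
have sN n : size (N n) = n.+2 by rewrite size_polyDl ?sl ?sP.
pose K n := N n %/ ('X - c%:P).
have eN n : N n = K n * ('X - c%:P).
  rewrite /K divpK // dvdp_XsubCl rootE /N !hornerE /l divfK ?subrr //.
have mK n : K n \is monic by rewrite -(monicMr _ mX) -eN.
have sK n : size (K n) = n.+1.
  by apply/eqP; rewrite -eqSS -(sN n) eN size_Mmonic ?monic_neq0 // size_XsubC addn2.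
have wK n q : mulfunctional ('X - c%:P) u (K n * q) = u (P n.+1 * q) - l n * u (P n * q).
  by rewrite /mulfunctional mulrA [_ * K n]mulrC -eN /N mulrBl linearB -scalerAl functionalZ.
have oK n m : (m < n)%N -> mulfunctional ('X - c%:P) u (K n * K m) = 0.
  by move=> mn; rewrite wK !(MOPS_orth hP) ?sK ?mulr0 ?subr0 // ltnW.
(* The norm is [- l n * u (P n ^+ 2)], and [l n] is nonzero by hypothesis. *)
have nK n : mulfunctional ('X - c%:P) u (K n ^+ 2) != 0.
  rewrite expr2 wK (MOPS_orth hP) ?sK // sub0r [P n * _]mulrC (MOPS_monic hP) ?sK //.
  by rewrite oppr_eq0 !mulf_neq0 ?invr_eq0.
exists K; split=> // n m; rewrite neq_ltn => /orP[|] /oK //.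
by rewrite mulrC.
Qed.

Context {u v : {scalar {poly F}}} {P Q : nat -> {poly F}} {r s t : nat -> F}.
Hypotheses (hP : MOPS u P) (hQ : MOPS v Q).
Hypothesis hrel : forall n,
  Q n + r n *: lag 1 Q n = P n + s n *: lag 1 P n + t n *: lag 2 P n.

Lemma structure_relation n :
  Q n.+2 = P n.+2 + s n.+2 *: P n.+1 + t n.+2 *: P n - r n.+2 *: Q n.+1.
Proof. by move: (hrel n.+2); rewrite /lag /= !subSS !subn0 => <-; rewrite addrK. Qed.

(** Against [P n], only the terms in [P n] and [Q n.+1] survive; the relation at [n.+1] evaluates
    the latter. *)
Lemma structure_coef n :
  u (Q n.+2 * P n) = (t n.+2 - r n.+2 * (s n.+1 - r n.+1)) * u (P n ^+ 2).
Proof.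
case: (hP) (hQ) => mP sP oP _ [mQ sQ _ _].
have oPn m : (n < m)%N -> u (P m * P n) = 0 by move=> nm; rewrite oP // gtn_eqF.
have e1 : u (Q n.+1 * P n) = (s n.+1 - r n.+1) * u (P n ^+ 2).
  move: (congr1 (fun p => u (p * P n)) (hrel n.+1)).
  rewrite /lag !ltnS leq0n subSS subn0 !mulrDl !linearD -!scalerAl !functionalZ.
  rewrite (MOPS_monic hP (mQ n) (sQ n)) -expr2 oPn //.
  (* For [n = 0] the lagged term is zero by the negative-index convention; otherwise it is
     orthogonal to [P n]. *)
  set z := u ((if _ then _ else _) * P n); have -> : z = 0.
    rewrite /z; case: (n) => [|m] /=; first by rewrite mul0r linear0.
    by rewrite subSS subn1 oP // ltn_eqF.
  by rewrite mulr0 addr0 add0r mulNr => <-; rewrite addrK.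
rewrite structure_relation !(mulrDl, mulNr) !(linearD, linearN) -!scalerAl !functionalZ e1.
by rewrite -expr2 (oPn n.+1) // (oPn n.+2) // mulr0 !add0r mulrA.
Qed.

(* The structure relation turns the hypothesis into [f (Q_{m+1}) = - r_{m+1} f (Q_m)]. *)
Lemma structure_vanish {f n} :
    (forall m, (n <= m)%N -> f (P m.+1 + s m.+1 *: P m + t m.+1 *: lag 2 P m.+1) = 0) ->
    f (Q n) = 0 ->
  forall m, (n <= m)%N -> f (Q m) = 0.
Proof.
move=> f0 fn m; elim: m => [|m IHm]; first by rewrite leqn0 => /eqP <-.
rewrite leq_eqVlt => /orP[/eqP <- //|]; rewrite ltnS => nm.
have := f0 m nm; have := hrel m.+1; rewrite {1 2}/lag /= !subSS !subn0 => <-.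
by rewrite linearD functionalZ IHm // mulr0 addr0.
Qed.

Lemma regular_iff_structure {c : F} :
  u (Q 2) != 0 -> u (('X - c%:P) * Q 3) = 0 ->
  regular (mulfunctional ('X - c%:P) u) <->
  (forall n, t n.+2 != r n.+2 * (s n.+1 - r n.+1)).
Proof.
move=> u2 u3; case: (hP) (hQ) => mP sP oP nP [mQ sQ oQ nQ].
have uP m q : (size q <= m)%N -> u (q * P m) = 0.
  by move=> sq; rewrite mulrC (MOPS_orth hP).
have uP0 m : (0 < m)%N -> u (P m) = 0 by move=> m0; rewrite -[P m]mul1r uP ?size_poly1.
have uP1 m : (1 < m)%N -> u (('X - c%:P) * P m) = 0 by move=> m0; rewrite uP ?size_XsubC.
have [phi sphi ephi] : exists2 phi : {poly F}, (size phi <= 3)%N &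
    forall p, mulfunctional ('X - c%:P) u p = v (phi * p).
  (* From index 3 on, the right-hand sides involve only [P j] with j >= 2, all orthogonal to x -
     c. *)
  apply: finite_dual_expansion hQ _; apply: structure_vanish => // -[|[|[|m]]] // _.
  rewrite /lag /= !subSS subn0 /mulfunctional /= !(mulrDr, linearD) -!scalerAr !functionalZ.
  by rewrite !uP1 // !mulr0 !addr0.
have uQ n : u (Q n.+2) != 0.
  apply/negP => /eqP un.
  have [q sq eq] : exists2 q : {poly F}, (size q <= n.+2)%N & forall p, u p = v (q * p).
    apply: finite_dual_expansion hQ _; apply: structure_vanish => // -[|[|m]] // _.
    by rewrite /lag /= !subSS subn0 !linearD !functionalZ !uP0 // !mulr0 !addr0.
  have e : ('X - c%:P) * q = phi.
    by apply: (mulfunctional_inj hQ) => p; rewrite -ephi /mulfunctional mulrAC mulrC -eq.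
  (* The bound from the expansion grows with [n]; comparing degrees in (x - c) [q] = [phi] replaces
     it by deg [q] <= 1. *)
  have {}sq : (size q <= 2)%N.
    have [->|q0] := eqVneq q 0; first by rewrite size_poly0.
    by move: sphi; rewrite -e size_monicM ?monicXsubC // size_XsubC.
  by move/eqP: u2; apply; rewrite eq mulrC (MOPS_orth hQ).
have key n : u (Q n.+2 * P n) = (P n).[c] * u (Q n.+2).
  have [k ek sk] := factor_at (P n) c; rewrite {1}ek mulrDr linearD mulrC mul_polyC functionalZ.
  (* The quotient part becomes [v (Q n.+2 * (phi * k))], which vanishes because [phi * k] has size
     at most [n.+2]. *)
  rewrite mulrCA -[u (_ * (_ * k))]/(mulfunctional _ u _) ephi mulrCA (MOPS_orth hQ) ?addr0 //.
  apply: leq_trans (size_polyMleq _ _) _; rewrite sP /= in sk.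
  by rewrite -subn1 leq_subLR (leq_add sphi sk).
have tP n : (t n.+2 != r n.+2 * (s n.+1 - r n.+1)) = ((P n).[c] != 0).
  have := congr1 (fun z => z == 0) (structure_coef n).
  by rewrite /= key !mulf_eq0 (negPf (uQ n)) (negPf (nP n)) !orbF subr_eq0 => ->.
rewrite (regular_mul_XsubC c hP).
by split=> h n; have := h n; rewrite tP.
Qed.

End OrthogonalPolynomials.

Theorem proposition2p2 (R : realType)
  (u v : {scalar {poly R[i]}}) (P Q : nat -> {poly R[i]})
  (hP : MOPS u P) (hQ : MOPS v Q)
  (hu1 : u 1 = 1) (hv1 : v 1 = 1)
  (beta gamma : nat -> R[i]) (hrec : recurrence_coeffs P beta gamma)
  (r s t : nat -> R[i])
  (hr0 : r 0%N = 0) (hs0 : s 0%N = 0) (ht0 : t 0%N = 0) (ht1 : t 1%N = 0)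
  (hrel : forall n : nat,
    Q n + r n *: lag 1 Q n = P n + s n *: lag 1 P n + t n *: lag 2 P n)
  (hinit2 : t 2%N != r 2%N * (s 1%N - r 1%N))
  (hinit3 : r 3%N * t 3%N != 0) :
  let c := beta 0%N - gamma 1%N / r 3%N *
      ((t 3%N - r 3%N * (s 2%N - r 2%N)) / (t 2%N - r 2%N * (s 1%N - r 1%N))) in
  regular (mulfunctional ('X - c%:P) u) <->
  (forall n : nat, (2 <= n)%N -> t n != r n * (s n.-1 - r n.-1)).
Proof.
case: (hP) (hQ) => mP sP oP nP [mQ sQ _ _]; case: hrec => P0 _ recP c.
have P1 : P 1%N = 'X - (beta 0%N)%:P by rewrite recP P0 mulr1 /lag /= scaler0 subr0.
have nP1 : u (P 1%N ^+ 2) = gamma 1%N.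
  (* Applying [u] to the recurrence for [P 2] gives gamma_1 = u((x - beta_1) P_1), where x - beta_1
     is monic of degree one. *)
  have := recP 1%N; rewrite /lag /= subnn P0 => /(congr1 u).
  rewrite linearB functionalZ hu1 mulr1 -[P 2%N]mulr1 (MOPS_orth hP) ?size_poly1 //.
  move=> /esym/eqP; rewrite subr_eq0 => /eqP <-.
  by apply/esym/(MOPS_monic hP); rewrite ?monicXsubC ?size_XsubC.
have u2 : u (Q 2%N) = t 2%N - r 2%N * (s 1%N - r 1%N).
  by have := structure_coef hP hQ hrel 0; rewrite P0 expr1n hu1 !mulr1.
have u1 m : (0 < m)%N -> u (P m) = 0.
  by move=> m0; rewrite -[P m]mulr1 (MOPS_orth hP) ?size_poly1.
have u3 : u (Q 3%N) = - (r 3%N * u (Q 2%N)).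
  by rewrite (structure_relation hrel) linearB !linearD !functionalZ !u1 // !mulr0 !addr0 sub0r.
have u2n0 : u (Q 2%N) != 0 by rewrite u2 subr_eq0.
have [r3 _] : r 3%N != 0 /\ t 3%N != 0 by move: hinit3; rewrite mulf_eq0 negb_or => /andP.
have uc : u (('X - c%:P) * Q 3%N) = 0.
  (* Expanding x - c around [P 1] gives gamma_1 (t_3 - r_3 (s_2 - r_2)) - (beta_0 - c) r_3 u(Q_2),
     and [c] is chosen as the root of this. *)
  have -> : 'X - c%:P = P 1%N + (beta 0%N - c)%:P by rewrite P1 [(_ - c)%:P]polyCB addrA subrK.
  rewrite mulrDl linearD mulrC (structure_coef hP hQ hrel 1) nP1 mul_polyC functionalZ u3 u2.
  rewrite /c subKr; by field; rewrite subr_eq0 hinit2 r3.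
have := regular_iff_structure hP hQ hrel u2n0 uc.
move=> ->; split=> [h [|[|n]] // _|h n]; exact: (h n.+2).
Qed.
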